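(* Let $\Lambda(V,B)$ be a geometric algebra over $B$. In the following, $x,y,x_1,\dots,x_p$ denote arbitrary elements of $V$ ($p\ge 1$) and $X,Y,Z$ arbitrary elements of $\Lambda(V,B)$. Then: 1. $1_{\mathrm{Cl}(B)}=1_\Lambda$ and $xX=x\wedge X+x\rfloor X$. 2. The two algebra structures (Clifford and Grassmann) have the same reversion $X\mapsto\widetilde X$, and $\widetilde X=(-1)^{r(r-1)/2}X$ for $X$ of grade $r$. 3a. $(X\lfloor Y)^{\sim}=\widetilde Y\rfloor\widetilde X$; $X*Y=\langle XY\rangle_0$; and, if $\mathrm{grade}(X)=r$ and $\mathrm{grade}(Y)=s$, $X\wedge Y=\langle XY\rangle_{r+s}$. 3b. If $\mathrm{grade}(X)=r$ and $\mathrm{grade}(Y)=s$, then $X\rfloor Y=\langle XY\rangle_{s-r}$, $X\lfloor Y=\langle XY\rangle_{r-s}$, and $XY=\sum_{i}\langle XY\rangle_i$, where $i$ runs from $|r-s|$ to $r+s$ in steps of $2$. 4. $(X\wedge Y)\rfloor Z=X\rfloor(Y\rfloor Z)$. 5. $x\rfloor y=B(x,y)1_\Lambda$ and $x\rfloor(XY)=(x\rfloor X)Y+\hat X(x\rfloor Y)$. 6. $x\rfloor y=B(x,y)1_\Lambda$ and $x\rfloor(X\wedge Y)=(x\rfloor X)\wedge Y+\hat X\wedge(x\rfloor Y)$. 7. $x\rfloor(x_1x_2\cdots x_p)=\sum_{k=1}^p(-1)^{k-1}x_1x_2\cdots(x\rfloor x_k)\cdots x_p$, where in the $k$-th term the factor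 $x_k$ is replaced by $x\rfloor x_k$. 8. $x\rfloor(x_1\wedge x_2\wedge\cdots\wedge x_p)=\sum_{k=1}^p(-1)^{k-1}x_1\wedge x_2\wedge\cdots\wedge(x\rfloor x_k)\wedge\cdots\wedge x_p$, where in the $k$-th term the factor $x_k$ is replaced by $x\rfloor x_k$. 9. If $x_1,x_2,\dots,x_p$ are pairwise orthogonal (i.e. $B(x_i,x_j)=0$ for $i\neq j$), then $\prod_{i=1}^px_i=\bigwedge_{i=1}^px_i$.
   Context: Setting: $R$ is a commutative ring with unit $1\neq 0$; $V\neq\{0\}$ is a free unitary $R$-module with basis $(e_i\mid i\in M)$, where $M$ (possibly infinite) is totally ordered by $<$; $B:V\times V\to R$ is a bilinear form which is diagonal in this basis, i.e. $B(e_i,e_j)=0$ for $i\ne j$; and $q(i)=B(e_i,e_i)$. $\mathcal{F}$ is the set of finite subsets of $M$, and $W=\bigoplus_{\mathcal{F}}R$ is the free $R$-module with basis $(e_K\mid K\in\mathcal{F})$. $V$ is regarded as a submodule of $W$ by identifying $e_i$ with $e_{\{i\}}$. $H\triangle J=(H\cup J)\setminus(H\cap J)$. For $H,J\in\mathcal{F}$: $\alpha(H,J)=\prod(-1)$ over all $(i,j)\in H\times J$ with $j<i$; $\beta(H,J)=\prod_{i\in H\cap J}q(i)$; $\sigma(H,J)=\alpha(H,J)\,\beta(H,J)$ (empty products equal $1$). $W_B=W$ is the associative unital $R$-algebra with unit $e_\emptyset$ whose product (the Clifford product, written by juxtaposition) is the bilinear extension of $e_He_J=\sigma(H,J)\,e_{H\triangle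 J}$. The same construction on the same module $W$ and basis with the zero bilinear form in place of $B$ gives the Grassmann algebra $W_0$, whose product is the outer product $\wedge$; thus $e_H\wedge e_K=\chi(H\cap K=\emptyset)\,e_He_K$, where $\chi(S)=1$ if the statement $S$ is true and $0$ otherwise. $W$ with both products is the double algebra $W_{B,0}$. A geometric algebra over $B$, denoted $\Lambda(V,B)$, is a double algebra (a module containing $V$ with two algebra products) isomorphic to $W_{B,0}$, respecting both products, with an isomorphism fixing $V$. The units of the Clifford and Grassmann structures are denoted $1_{\mathrm{Cl}(B)}$ and $1_\Lambda$. In $W_{B,0}$ define, by bilinearity: the scalar product $e_H*e_K=\chi(H=K)\,e_He_K$; the left contraction $e_H\rfloor e_K=\chi(H\subseteq K)\,e_He_K$; the right contraction $e_H\lfloor e_K=\chi(H\supseteq K)\,e_He_K$. These are carried over to $\Lambda(V,B)$ by the isomorphism. Grading is taken from the Grassmann structure: $X$ has grade $r$ if $X\in\Lambda_r(V)$, where $\Lambda_r(V)=\mathrm{span}\{a_1\wedge\cdots\wedge a_r\mid a_i\in V\}$ for $r\ge0$ (the empty product being the unit) and $\Lambda_r(V)=\{0\}$ for $r<0$; the whole space is $\bigoplus_r\Lambda_r(V)$, and $\langle X\rangle_r$ is the projection of $X$ on $\Lambda_r(V)$ along $\bigoplus_{i\ne r}\Lambda_i(V)$. The main automorphism $X\mapsto\hat X$ is the unique morphism of the Clifford algebra with $\hat x=-x$ for $x\in V$. The reversion $X\mapsto\widetilde X$ of the Clifford (resp. Grassmann) structure is the unique linear map fixing the unit and $V$ and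 reversing products: $(XY)^\sim=\widetilde Y\widetilde X$ (resp. the same with $\wedge$). *)

(* Defs.v *)
From HB Require Import structures.
From Stdlib Require Import ClassicalEpsilon.
From mathcomp Require Import all_boot all_order all_algebra.
From mathcomp Require Import finmap sesquilinear.
From mathcomp Require Export monalg.

Set Implicit Arguments.
Unset Strict Implicit.
Unset Printing Implicit Defensive.

Import Order.TTheory GRing.Theory Num.Theory.

Local Open Scope fset_scope.
Local Open Scope ring_scope.

Section LinearAlgebra.
Context (R : comNzRingType).

Definition is_basis (M : choiceType) (V : lmodType R) (e : M -> V) : Prop :=
  (forall v : V, exists (K : {fset M}) (c : M -> R),
     v = \sum_(i <- K) c i *: e i) /\
  (forall (K : {fset M}) (c : M -> R),
     \sum_(i <- K) c i *: e i = 0 -> forall i, i \in K -> c i = 0).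

Definition lin_span (L : lmodType R) (S : L -> Prop) (X : L) : Prop :=
  exists (n : nat) (c : 'I_n -> R) (v : 'I_n -> L),
    (forall i, S (v i)) /\ X = \sum_(i < n) c i *: v i.

(* An associative unital R-algebra structure on a given module; a double
   algebra is a module carrying two of these. *)
Record algebra_on (L : lmodType R) := AlgebraOn {
  amul :> {bilinear L -> L -> L};
  aone : L;
  amulA : associative amul;
  amul1X : left_id aone amul;
  amulX1 : right_id aone amul
}.

(* Bilinear extension, from the basis << K >> of {malg R[T]}. *)
Definition lift2 (T : choiceType) (L : lmodType R) (f : T -> T -> L)
    (X Y : {malg R[T]}) : L :=
  \sum_(H <- msupp X) \sum_(J <- msupp Y) (X@_H * Y@_J) *: f H J.

Section Lift2.
Context (T : choiceType) (L : lmodType R) (f : T -> T -> L).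

Lemma lift2Ew (A B : {fset T}) (X Y : {malg R[T]}) :
  msupp X `<=` A -> msupp Y `<=` B ->
  lift2 f X Y = \sum_(H <- A) \sum_(J <- B) (X@_H * Y@_J) *: f H J.
Proof.
move=> sA sB; rewrite /lift2 (big_fset_incl _ sA) /=; last first.
  by move=> H _ /mcoeff_outdom XH; apply: big1 => J _; rewrite XH mul0r scale0r.
apply: eq_bigr => H _; apply: (big_fset_incl _ sB) => J _ /mcoeff_outdom YJ.
by rewrite YJ mulr0 scale0r.
Qed.

Lemma lift2_bilinear : bilinear_for *:%R *:%R (lift2 f).
Proof.
split=> [Y|X] a U Z; pose A := msupp U `|` msupp Z `|` msupp (a *: U + Z).
- have sA (W : {malg R[T]}) : W \in [:: U; Z; a *: U + Z] -> msupp W `<=` A.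
    rewrite !inE => sW; apply/fsubsetP => H HW; rewrite !inE.
    by case/or3P: sW HW => /eqP <- ->; rewrite ?orbT.
  rewrite /= !(@lift2Ew A (msupp Y)) ?fsubset_refl ?sA ?inE ?eqxx ?orbT //.
  rewrite scaler_sumr -big_split /=; apply: eq_bigr => H _.
  rewrite scaler_sumr -big_split /=; apply: eq_bigr => J _.
  by rewrite mcoeffD mcoeffZ mulrDl scalerDl -mulrA scalerA.
- have sA (W : {malg R[T]}) : W \in [:: U; Z; a *: U + Z] -> msupp W `<=` A.
    rewrite !inE => sW; apply/fsubsetP => H HW; rewrite !inE.
    by case/or3P: sW HW => /eqP <- ->; rewrite ?orbT.
  rewrite /= !(@lift2Ew (msupp X) A) ?fsubset_refl ?sA ?inE ?eqxx ?orbT //.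
  rewrite scaler_sumr -big_split /=; apply: eq_bigr => H _.
  rewrite scaler_sumr -big_split /=; apply: eq_bigr => J _.
  by rewrite mcoeffD mcoeffZ mulrDr scalerDl mulrCA scalerA.
Qed.

HB.instance Definition _ :=
  bilinear_isBilinear.Build R {malg R[T]} {malg R[T]} L *:%R *:%R
    (lift2 f) lift2_bilinear.

Lemma lift2U (H J : T) : lift2 f << H >> << J >> = f H J.
Proof.
by rewrite /lift2 !msuppU oner_eq0 !big_seq_fset1 !mcoeffUU mulr1 scale1r.
Qed.

End Lift2.

Lemma malg_linear_ext (T : choiceType) (L : lmodType R)
    (f g : {malg R[T]} -> L) :
  linear f -> linear g -> (forall k, f << k >> = g << k >>) -> f =1 g.
Proof.
move=> linf ling fg X.
have lin0 h : linear h -> h 0 = 0 :> L.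
  by move=> linh; have := linh (-1) 0 0; rewrite !scaler0 addr0 scaleN1r addNr.
have E : X = \sum_(k <- msupp X) X@_k *: << k >>.
  rewrite {1}[X]monalgE; apply: eq_bigr => k _.
  by apply/malgP => k'; rewrite mcoeffZ !mcoeffU mulrnAr mulr1.
rewrite E; elim: (enum_fset _) => [|k s IHs]; first by rewrite big_nil !lin0.
by rewrite big_cons linf ling fg IHs.
Qed.

End LinearAlgebra.

Section CliffordConstruction.
Context (R : comNzRingType) (d : Order.disp_t) (M : orderType d).
Implicit Types (H J K : {fset M}) (q : M -> R).

Definition symdiff H J : {fset M} := (H `|` J) `\` (H `&` J).

Definition alpha H J : R := \prod_(i <- H) \prod_(j <- J | (j < i)%O) (-1).
Definition beta q H J : R := \prod_(i <- H `&` J) q i.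
Definition sigma q H J : R := alpha H J * beta q H J.

Definition basis_mul q H J : {malg R[{fset M}]} :=
  sigma q H J *: << symdiff H J >>.

Lemma in_symdiff H J i : (i \in symdiff H J) = (i \in H) (+) (i \in J).
Proof. by rewrite !inE; case: (i \in H); case: (i \in J). Qed.

Lemma symdiffA : associative symdiff.
Proof. by move=> H J K; apply/fsetP => i; rewrite !in_symdiff addbA. Qed.

Lemma prod_indic (U H : {fset M}) (F : M -> R) : H `<=` U ->
  \prod_(i <- H) F i = \prod_(i <- U) (if i \in H then F i else 1).
Proof.
move=> sHU; rewrite -(big_fset_incl _ sHU) /=; last by move=> i _ /negPf ->.
by apply: eq_fbigr => i iH; rewrite iH.
Qed.

Lemma prod_symdiff H J (F : M -> R) : (forall i, F i * F i = 1) ->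
  \prod_(i <- symdiff H J) F i = \prod_(i <- H) F i * \prod_(i <- J) F i.
Proof.
move=> FF; pose U := H `|` J.
have sH : H `<=` U by exact: fsubsetUl.
have sJ : J `<=` U by exact: fsubsetUr.
have sHJ : symdiff H J `<=` U by exact: fsubsetDl.
rewrite (prod_indic _ sHJ) (prod_indic _ sH) (prod_indic _ sJ) -big_split /=; apply: eq_bigr => i _; rewrite in_symdiff.
by case: (i \in H); case: (i \in J); rewrite /= ?mulr1 ?mul1r ?FF.
Qed.

Lemma alpha_symdiffl H J K : alpha (symdiff H J) K = alpha H K * alpha J K.
Proof.
apply: prod_symdiff => i; rewrite -big_split big1 // => j _.
by rewrite /= mulrNN mulr1.
Qed.

Lemma alpha_symdiffr H J K : alpha H (symdiff J K) = alpha H J * alpha H K.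
Proof.
rewrite /alpha -big_split; apply: eq_bigr => i _ /=.
rewrite !(big_mkcond (fun j => (j < i)%O)) prod_symdiff // => j.
by case: ifP; rewrite ?mulrNN mulr1.
Qed.

Lemma beta_assoc q H J K :
  beta q H J * beta q (symdiff H J) K = beta q J K * beta q H (symdiff J K).
Proof.
pose U := H `|` J `|` K.
have sU A : (forall i, i \in A -> [|| i \in H, i \in J | i \in K]) -> A `<=` U.
  by move=> sA; apply/fsubsetP => i /sA; rewrite !inE orbA.
have s1 : H `&` J `<=` U by apply: sU => i; rewrite inE => /andP[->].
have s2 : symdiff H J `&` K `<=` U.
  by apply: sU => i; rewrite inE => /andP[_ ->]; rewrite !orbT.
have s3 : J `&` K `<=` U.
  by apply: sU => i; rewrite inE => /andP[_ ->]; rewrite !orbT.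
have s4 : H `&` symdiff J K `<=` U by apply: sU => i; rewrite inE => /andP[->].
rewrite /beta (prod_indic _ s1) (prod_indic _ s2) (prod_indic _ s3).
rewrite (prod_indic _ s4) -!big_split /=; apply: eq_bigr => i _; rewrite !(in_fsetI, in_symdiff).
by case: (i \in H); case: (i \in J); case: (i \in K); rewrite /= ?mulr1 ?mul1r.
Qed.

Lemma sigma_assoc q H J K :
  sigma q H J * sigma q (symdiff H J) K =
  sigma q J K * sigma q H (symdiff J K).
Proof.
rewrite /sigma alpha_symdiffl alpha_symdiffr mulrACA (mulrACA (alpha J K)).
rewrite beta_assoc; congr (_ * _).
by rewrite mulrA [RHS]mulrC.
Qed.

Lemma clifford_mulA q : associative (lift2 (basis_mul q)).
Proof.
move=> X Y Z; pose m := lift2 (basis_mul q).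
apply: (malg_linear_ext (f := fun X => m X (m Y Z))
                        (g := fun X => m (m X Y) Z)) => [a U T|a U T|H].
- by rewrite /m linearPl.
- by rewrite /m !linearPl.
apply: (malg_linear_ext (f := fun Y => m << H >> (m Y Z))
                        (g := fun Y => m (m << H >> Y) Z)) => [a U T|a U T|J].
- by rewrite /m linearPl linearPr.
- by rewrite /m linearPr linearPl.
apply: (malg_linear_ext (f := fun Z => m << H >> (m << J >> Z))
                        (g := fun Z => m (m << H >> << J >>) Z)) => [a U T|a U T|K].
- by rewrite /m !linearPr.
- by rewrite /m linearPr.
rewrite /m !lift2U /basis_mul linearZr linearZl /= !lift2U /basis_mul.
by rewrite !scalerA symdiffA sigma_assoc.
Qed.

Lemma clifford_mul1X q : left_id << fset0 >> (lift2 (basis_mul q)).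
Proof.
pose m := lift2 (basis_mul q).
apply: (malg_linear_ext (f := m << fset0 >>) (g := id)) => [a U T|a U T|H] //.
- by rewrite /m linearPr.
rewrite /m lift2U /basis_mul /sigma /alpha /beta fset0I !big_seq_fset0 mulr1.
rewrite scale1r; congr (<< _ >>).
by apply/fsetP => i; rewrite in_symdiff inE.
Qed.

Lemma clifford_mulX1 q : right_id << fset0 >> (lift2 (basis_mul q)).
Proof.
pose m := lift2 (basis_mul q).
apply: (malg_linear_ext (f := m ^~ << fset0 >>) (g := id)) => [a U T|a U T|H] //.
- by rewrite /m linearPl.
rewrite /m lift2U /basis_mul /sigma /alpha /beta fsetI0.
rewrite big_seq_fset0 mulr1 big1 => [|i _]; last by rewrite big_mkcond big_seq_fset0.
rewrite scale1r; congr (<< _ >>).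
by apply/fsetP => i; rewrite in_symdiff inE addbF.
Qed.

Definition clifford_alg q : algebra_on {malg R[{fset M}]} :=
  AlgebraOn (clifford_mulA q) (clifford_mul1X q) (clifford_mulX1 q).

End CliffordConstruction.

Section GeometricAlgebra.
Context (R : comNzRingType) (d : Order.disp_t) (M : orderType d).
Context (V : lmodType R) (e : M -> V).

Local Notation W := {malg R[{fset M}]}.

Definition W_alg (B : V -> V -> R) : algebra_on W :=
  clifford_alg (fun i => B (e i) (e i)).

(* The double algebra W_{B,0} transported to a module containing V.  Both
   ga_emb and ga_iso are linear, so ga_isoV says that the isomorphism is the
   identity on V, where e i in V is identified with << [fset i] >> in W. *)
Record geometric_algebra (B : V -> V -> R) := GeometricAlgebra {
  ga_mod :> lmodType R;
  ga_emb : {linear V -> ga_mod};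
  ga_emb_inj : injective ga_emb;
  ga_cl : algebra_on ga_mod;
  ga_gr : algebra_on ga_mod;
  ga_iso : {linear W -> ga_mod};
  ga_inv : ga_mod -> W;
  ga_isoK : cancel ga_iso ga_inv;
  ga_invK : cancel ga_inv ga_iso;
  ga_isoV : forall i, ga_iso << [fset i] >> = ga_emb (e i);
  ga_iso_cl : forall X Y, ga_iso (W_alg B X Y) = ga_cl (ga_iso X) (ga_iso Y);
  ga_iso_gr : forall X Y,
    ga_iso (W_alg (fun _ _ => 0) X Y) = ga_gr (ga_iso X) (ga_iso Y)
}.

Section Operations.
Context (B : V -> V -> R) (G : geometric_algebra B).
Implicit Types (X Y Z : G) (r s : int).

Definition chi (P : bool) : R := if P then 1 else 0.

Definition W_scal : W -> W -> W :=
  lift2 (fun H K => chi (H == K) *: W_alg B << H >> << K >>).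
Definition W_lcontr : W -> W -> W :=
  lift2 (fun H K => chi (H `<=` K) *: W_alg B << H >> << K >>).
Definition W_rcontr : W -> W -> W :=
  lift2 (fun H K => chi (K `<=` H) *: W_alg B << H >> << K >>).

Definition ga_transport (f : W -> W -> W) X Y : G :=
  ga_iso G (f (ga_inv X) (ga_inv Y)).

Definition ga_scal : G -> G -> G := ga_transport W_scal.
Definition ga_lcontr : G -> G -> G := ga_transport W_lcontr.
Definition ga_rcontr : G -> G -> G := ga_transport W_rcontr.
Definition ga_clmul : G -> G -> G := ga_cl G.
Definition ga_wedge : G -> G -> G := ga_gr G.

Definition has_grade r X : Prop :=
  match r with
  | Posz n => lin_span (fun Y => exists a : 'I_n -> V,
      Y = \big[ga_wedge/aone (ga_gr G)]_(i < n) ga_emb G (a i)) X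
  | Negz _ => X = 0
  end.

Definition is_gproj r X Y : Prop :=
  has_grade r Y /\ lin_span (fun Z => exists2 i : int, i != r & has_grade i Z) (X - Y).

(* The three uses of epsilon describe objects that exist uniquely: G is the
   direct sum of its homogeneous subspaces, and both algebra structures are
   generated by V. *)
Definition gproj r X : G := epsilon (inhabits 0) (is_gproj r X).

Definition is_main_automorphism (f : G -> G) : Prop :=
  [/\ linear f, f (aone (ga_cl G)) = aone (ga_cl G),
      forall X Y, f (ga_cl G X Y) = ga_cl G (f X) (f Y)
    & forall x, f (ga_emb G x) = - ga_emb G x].

Definition main_automorphism : G -> G :=
  epsilon (inhabits id) is_main_automorphism.

Definition is_reversion (A : algebra_on G) (f : G -> G) : Prop :=
  [/\ linear f, f (aone A) = aone A, forall x, f (ga_emb G x) = ga_emb G x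
    & forall X Y, f (A X Y) = A (f Y) (f X)].

Definition reversion (A : algebra_on G) : G -> G :=
  epsilon (inhabits id) (is_reversion A).

End Operations.
End GeometricAlgebra.

Arguments ga_clmul {R d M V e B} G X Y.
Arguments ga_wedge {R d M V e B} G X Y.
Arguments main_automorphism {R d M V e B} G X.

Notation "X \cl Y" := (ga_clmul _ X Y) (at level 40, left associativity).
Notation "X \wg Y" := (ga_wedge _ X Y) (at level 40, left associativity).
Notation "X \sp Y" := (ga_scal X Y) (at level 40, left associativity).
Notation "X \lc Y" := (ga_lcontr X Y) (at level 40, left associativity).
Notation "X \rc Y" := (ga_rcontr X Y) (at level 40, left associativity).

(* Main.v *)
Require Import Defs.
From mathcomp Require Import all_boot all_order all_algebra.
From mathcomp Require Import finmap sesquilinear.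
From Stdlib Require Import ClassicalEpsilon.
From mathcomp Require Import ring zify.

Set Implicit Arguments.
Unset Strict Implicit.
Unset Printing Implicit Defensive.

Import Order.TTheory GRing.Theory Num.Theory.
Local Open Scope fset_scope.
Local Open Scope ring_scope.

(** In the model W the five products are all of one shape: on basis elements
    they are the Clifford product e_H e_K, kept or replaced by 0 according to a
    relation rho between the index sets H and K ([filtered_mul]).  The relations
    are: no restriction (Clifford), disjointness (Grassmann), equality (scalar
    product), inclusion and reverse inclusion (contractions).  Reversion, the
    main automorphism and the grade projections are likewise all of one shape:
    they multiply each e_K by a scalar depending on K ([diagonal]).  Every
    identity of the theorem is multilinear, so it reduces to basis elements;
    there it splits into an identity of the Clifford product, free of any
    relation, and a Boolean identity between relations on index sets.

    Write H + K for the symmetric difference.  The Clifford part rests on the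
    sign alpha being multiplicative for + in each argument.  Two consequences
    carry most of the weight.  The sign of reversion on e_K is alpha K K, which
    makes its compatibility with products a formal expansion of alpha on H + J in
    both arguments ([rev_sign_symdiff]), and which is shown by induction to be
    (-1) ^ 'C(#K, 2) ([rev_signE]).  And moving e_i across e_K costs (-1) ^ #K, with one more sign when i is in K
    ([alpha_fset1_swap]); this gives the antiderivation property of the
    contraction by a vector for the Clifford and the outer product at once
    ([lcontr_antiderivation]).  The grade formulas come from
    #(H + K) + 2 #(H meet K) = #H + #K: the product e_H e_K attains the grade
    #H + #K, #K - #H, #H - #K or 0 exactly when H and K are disjoint, H is
    included in K, K is included in H, or H = K.

    It remains to carry this over to an arbitrary geometric algebra.  Reversion,
    main automorphism and grade projections are specified there by their
    characteristic properties, so the transported diagonal maps are shown to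
    have these properties and to be the only maps that do: both algebras are
    generated by V ([generated_ext]), and the homogeneous elements of grade r are
    the combinations of the e_K with #K = r ([has_gradeE]).

    The formulas for the contraction of a product of vectors follow from the
    antiderivation property by induction on the number of factors; for pairwise
    orthogonal vectors all contractions vanish, and x X = x ^ X + x _| X then
    identifies the two products inductively. *)

(** * Signs of finite index sets *)

Section Signs.
Context (R : comNzRingType) (d : Order.disp_t) (M : orderType d).
Implicit Types (H J K : {fset M}) (q : M -> R).

Definition parity_sign K : R := (-1) ^+ #|` K|.

(** The number of pairs (i, j) in K x K with j < i is 'C(#K, 2), so this is the
    sign of the reversal of #K factors. *)
Definition rev_sign K : R := alpha R K K.

Lemma parity_signE K : parity_sign K = \prod_(i <- K) (-1).
Proof. by rewrite big_const_seq count_predT -Monoid.iteropE. Qed.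

Lemma parity_sign_symdiff H J :
  parity_sign (symdiff H J) = parity_sign H * parity_sign J.
Proof. by rewrite !parity_signE prod_symdiff // => _; rewrite mulrNN mulr1. Qed.

Lemma symdiffC H J : symdiff H J = symdiff J H.
Proof. by apply/fsetP => i; rewrite !in_symdiff addbC. Qed.

Lemma symdiffK H J : symdiff H (symdiff H J) = J.
Proof. by apply/fsetP => i; rewrite !in_symdiff addKb. Qed.

Lemma symdiff_fset1 i K : i \notin K -> symdiff [fset i] K = i |` K.
Proof.
move=> iK; apply/fsetP => j; rewrite in_symdiff !inE.
by case: eqP => [->|]; rewrite ?(negPf iK).
Qed.

Lemma alpha_sqr H J : alpha R H J * alpha R H J = 1.
Proof.
rewrite -alpha_symdiffl /alpha big1_seq // => i.
by rewrite in_symdiff addbb andbF.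
Qed.

(** Expanding alpha in both arguments leaves the two cross terms alpha H J and
    alpha J H, of which the first is cancelled by alpha H J itself. *)
Lemma rev_sign_symdiff H J :
  rev_sign (symdiff H J) * alpha R H J = rev_sign H * rev_sign J * alpha R J H.
Proof.
rewrite /rev_sign alpha_symdiffl !alpha_symdiffr.
have := alpha_sqr H J; move: (alpha _ _ _) => a E.
by rewrite -[RHS]mulr1 -E; ring.
Qed.

Lemma betaC q H J : beta q H J = beta q J H.
Proof. by rewrite /beta fsetIC. Qed.

(** Every element of K other than i lies on exactly one side of i and so
    contributes one factor -1 to the product of the two signs. *)
Lemma alpha_fset1_swap i K :
  alpha R K [fset i] =
  parity_sign K * (-1) ^+ (i \in K) * alpha R [fset i] K.
Proof.
suff E : alpha R [fset i] K * alpha R K [fset i] =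
         parity_sign K * (-1) ^+ (i \in K).
  by rewrite -E -mulrA mulrC -!mulrA alpha_sqr mulr1.
rewrite /alpha big_seq_fset1 big_mkcond -big_split /=.
have -> : (-1) ^+ (i \in K) = \prod_(j <- K) (if j == i then -1 else 1) :> R.
  case: (boolP (i \in K)) => iK.
    rewrite (big_fsetD1 i) //= eqxx big1_seq ?mulr1 // => j.
    by rewrite !inE => /andP[_ /andP[/negPf->]].
  rewrite big1_seq // => j /andP[_ jK]; case: eqP => // ji.
  by rewrite -ji jK in iK.
rewrite parity_signE -big_split; apply: eq_bigr => j _ /=.
rewrite big_mkcond big_seq_fset1.
by case: ltgtP; rewrite ?mulrNN ?mulr1 ?mul1r.
Qed.

(** Removing i from K, the cross terms alpha i L and alpha L i multiply to
    (-1) ^ #L, which is Pascal's rule in the exponent. *)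
Lemma rev_signE K : rev_sign K = (-1) ^+ 'C(#|` K|, 2).
Proof.
have [n] := ubnP #|` K|; elim: n K => // n IHn K.
have [->|[i iK]] := fset_0Vmem K.
  by rewrite /rev_sign /alpha big_seq_fset0 cardfs0.
rewrite -(fsetD1K iK); set L := K `\ i; have iL : i \notin L by rewrite !inE eqxx.
rewrite cardfsU1 iL add1n ltnS => /IHn {IHn} IH.
rewrite binS bin1 exprD -IH -symdiff_fset1 // /rev_sign.
rewrite alpha_symdiffl !alpha_symdiffr (alpha_fset1_swap i L) (negPf iL) mulr1.
have -> : alpha R [fset i] [fset i] = 1.
  by rewrite /alpha big_seq_fset1 big_mkcond big_seq_fset1 ltxx.
have := alpha_sqr [fset i] L; rewrite /parity_sign.
move: (alpha R [fset i] L) (_ ^+ _) => a s aa.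
by rewrite -[RHS]mul1r -{2}aa; ring.
Qed.

Lemma cardfs_symdiff H J :
  (#|` symdiff H J| + 2 * #|` H `&` J| = #|` H| + #|` J|)%N.
Proof.
have := cardfsUI H J; rewrite /symdiff cardfsDS; last first.
  exact: fsubset_trans (fsubsetIl _ _) (fsubsetUl _ _).
have : (#|` H `&` J| <= #|` H `|` J|)%N.
  by apply: fsubset_leq_card; exact: fsubset_trans (fsubsetIl _ _) (fsubsetUl _ _).
lia.
Qed.

Lemma fsubset_cardsI H J : (H `<=` J) = (#|` H `&` J| == #|` H|).
Proof.
by rewrite (fsubset_leqif_cards (fsubsetIl H J)); apply/fsetIidPl/eqP.
Qed.
End Signs.

(** * Linear maps on free modules *)

Section LinearMaps.
Context (R : comNzRingType).

Lemma linear_map0 (L L' : lmodType R) (h : L -> L') : linear h -> h 0 = 0.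
Proof.
by move=> linh; have := linh (-1) 0 0; rewrite !scaler0 addr0 scaleN1r addNr.
Qed.

Lemma linear_mapZ (L L' : lmodType R) (h : L -> L') a X :
  linear h -> h (a *: X) = a *: h X.
Proof.
by move=> linh; have := linh a X 0; rewrite !addr0 (linear_map0 linh) addr0.
Qed.

Lemma scaler_congr (L : lmodType R) (a b : R) (X : L) : a = b -> a *: X = b *: X.
Proof. by move->. Qed.

Lemma basis_linear_ext (I : choiceType) (V L : lmodType R) (e : I -> V)
    (f g : V -> L) :
  is_basis e -> linear f -> linear g -> (forall i, f (e i) = g (e i)) -> f =1 g.
Proof.
move=> [span _] linf ling fg x; have [K [c ->]] := span x.
elim: (enum_fset K) => [|i s IHs]; first by rewrite big_nil !linear_map0.
by rewrite big_cons linf ling fg IHs.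
Qed.

Lemma lin_span_ext (L L' : lmodType R) (S : L -> Prop) (f g : L -> L') (X : L) :
  linear f -> linear g -> (forall Y, S Y -> f Y = g Y) ->
  lin_span S X -> f X = g X.
Proof.
move=> linf ling fg [n [c [v [Sv ->]]]].
elim: (index_enum _) => [|i s IHs]; first by rewrite big_nil !linear_map0.
by rewrite big_cons linf ling fg // IHs.
Qed.

Lemma lin_span_sum (I : eqType) (L : lmodType R) (S : L -> Prop) (s : seq I)
    (P : pred I) (c : I -> R) (F : I -> L) :
  (forall i, i \in s -> P i -> S (F i)) ->
  lin_span S (\sum_(i <- s | P i) c i *: F i).
Proof.
move=> SF; rewrite -big_filter; set t := filter P s.
exists (size t), (fun j => c (tnth (in_tuple t) j)),
  (fun j => F (tnth (in_tuple t) j)).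
split=> [j|]; last by rewrite big_tnth.
have : tnth (in_tuple t) j \in t by exact: mem_tnth.
by rewrite mem_filter => /andP[Pj sj]; exact: SF.
Qed.
End LinearMaps.

Lemma big_nat_only (L : nmodType) (n m : nat) (P : pred nat) (F : nat -> L) :
  (m < n)%N -> P m -> (forall i, i != m -> F i = 0) ->
  \sum_(0 <= i < n | P i) F i = F m.
Proof.
move=> mn Pm F0; rewrite big_mkcond (bigD1_seq m) ?iota_uniq ?mem_index_iota //= Pm.
by rewrite big1 ?addr0 // => i /F0 ->; case: ifP.
Qed.

(** * Diagonal operators and grade projections *)

Section Diagonal.
Context (R : comNzRingType) (T : choiceType).
Local Notation W := {malg R[T]}.

Definition diagonal (f : T -> R) (X : W) : W :=
  \sum_(K <- msupp X) (f K * X@_K) *: << K >>.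

Lemma diagonalE f (X : W) :
  diagonal f X = \sum_(K <- msupp X) (f K * X@_K) *: << K >>.
Proof. by []. Qed.

Lemma malg_expansion (X : W) : X = \sum_(K <- msupp X) X@_K *: << K >>.
Proof.
rewrite {1}[X]monalgE; apply: eq_bigr => k _.
by apply/malgP => k'; rewrite mcoeffZ !mcoeffU mulrnAr mulr1.
Qed.

Lemma mcoeff_diagonal f (X : W) K : (diagonal f X)@_K = f K * X@_K.
Proof.
rewrite /diagonal raddf_sum /=; case: (boolP (K \in msupp X)) => KX.
  rewrite (big_fsetD1 K) //= mcoeffZ mcoeffUU mulr1 big1_seq ?addr0 // => J.
  by rewrite !inE => /andP[_ /andP[/negPf JK _]]; rewrite mcoeffZ mcoeffU JK mulr0.
rewrite (mcoeff_outdom KX) mulr0 big1_seq // => J /andP[_ JX].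
rewrite mcoeffZ mcoeffU; case: eqP => [E|]; rewrite ?mulr0 //.
by rewrite -E JX in KX.
Qed.

Lemma diagonalP f a X Y : diagonal f (a *: X + Y) = a *: diagonal f X + diagonal f Y.
Proof.
apply/malgP => K; rewrite mcoeffD mcoeffZ !mcoeff_diagonal.
by rewrite mcoeffD mcoeffZ mulrDr mulrCA.
Qed.

Lemma diagonalZ f a X : diagonal f (a *: X) = a *: diagonal f X.
Proof. by apply/malgP => K; rewrite mcoeffZ !mcoeff_diagonal mcoeffZ mulrCA. Qed.

Lemma diagonalU f K : diagonal f << K >> = f K *: << K >>.
Proof.
apply/malgP => J; rewrite mcoeff_diagonal mcoeffZ mcoeffU.
by case: eqP => [->|]; rewrite ?mulr0.
Qed.

Lemma bilinear_ext (L : lmodType R) (f g : W -> W -> L) :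
  (forall Y, linear (f^~ Y)) -> (forall X, linear (f X)) ->
  (forall Y, linear (g^~ Y)) -> (forall X, linear (g X)) ->
  (forall H K, f << H >> << K >> = g << H >> << K >>) -> forall X Y, f X Y = g X Y.
Proof.
move=> fl fr gl gr fg X Y; apply: (malg_linear_ext (fl Y) (gl Y)) => H.
exact: (malg_linear_ext (fr << H >>) (gr << H >>)).
Qed.
End Diagonal.

Section GradeProjection.
Context (R : comNzRingType) (d : Order.disp_t) (M : orderType d).
Local Notation W := {malg R[{fset M}]}.
Implicit Types (X Y : W) (r : int) (K : {fset M}).

Definition grade_proj r : W -> W :=
  diagonal (fun K => chi R ((#|` K| : int) == r)).

Lemma grade_proj_diagonal r :
  grade_proj r = diagonal (fun K => chi R ((#|` K| : int) == r)).
Proof. by []. Qed.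

Lemma mcoeff_grade_proj r X K :
  (grade_proj r X)@_K = if (#|` K| : int) == r then X@_K else 0.
Proof.
by rewrite mcoeff_diagonal /chi; case: ifP; rewrite ?mul1r ?mul0r.
Qed.

Lemma grade_projP r a X Y :
  grade_proj r (a *: X + Y) = a *: grade_proj r X + grade_proj r Y.
Proof. exact: diagonalP. Qed.

Lemma grade_projB r X Y : grade_proj r (X - Y) = grade_proj r X - grade_proj r Y.
Proof. by rewrite -(scaleN1r Y) (addrC X) grade_projP scaleN1r [LHS]addrC. Qed.

Lemma grade_projZ r a X : grade_proj r (a *: X) = a *: grade_proj r X.
Proof. exact: diagonalZ. Qed.

Lemma grade_projUE r (K : {fset M}) :
  grade_proj r (<< K >> : W) = chi R ((#|` K| : int) == r) *: << K >>.
Proof. exact: diagonalU. Qed.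

Lemma grade_projU r (K : {fset M}) :
  (#|` K| : int) = r -> grade_proj r (<< K >> : W) = << K >>.
Proof. by move=> E; rewrite grade_projUE E /chi eqxx scale1r. Qed.

Opaque grade_proj.

Lemma grade_projK r X : grade_proj r (grade_proj r X) = grade_proj r X.
Proof.
apply/malgP => K; move: (mcoeff_grade_proj r X K); move: (grade_proj r X) => Z E.
by rewrite mcoeff_grade_proj E; case: (_ == _).
Qed.

Lemma grade_proj_disjoint r s X : r != s -> grade_proj s X = X -> grade_proj r X = 0.
Proof.
move=> rs <-; apply/malgP => K; rewrite !mcoeff_grade_proj mcoeff0.
by case: eqP => // ->; rewrite (negPf rs).
Qed.

End GradeProjection.

Opaque diagonal grade_proj.

(** * Products restricted by a relation *)

Section FilteredProduct.
Context (R : comNzRingType) (d : Order.disp_t) (M : orderType d).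
Implicit Types (H J K : {fset M}) (rho : {fset M} -> {fset M} -> bool).
Local Notation W := {malg R[{fset M}]}.
Local Notation chi := (chi R).

(** A single family containing all five products; see [clifford_filtered],
    [grassmann_filtered] and [W_contractionsE]. *)
Definition filtered_mul (q : M -> R) rho : W -> W -> W :=
  lift2 (fun H K => chi (rho H K) *: clifford_alg q << H >> << K >>).

Definition all_pairs H K := true.
Definition contained H K := H `<=` K.
Definition containing H K := K `<=` H.
Definition disjoint_pairs H K := H `&` K == fset0.

Lemma filtered_mulU q rho H K :
  filtered_mul q rho << H >> << K >> =
  (chi (rho H K) * sigma q H K) *: << symdiff H K >>.
Proof. by rewrite /filtered_mul lift2U /= lift2U scalerA. Qed.

Lemma filtered_mulPl q rho a U V Y :
  filtered_mul q rho (a *: U + V) Y =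
  a *: filtered_mul q rho U Y + filtered_mul q rho V Y.
Proof. by rewrite /filtered_mul linearPl. Qed.

Lemma filtered_mulPr q rho a X U V :
  filtered_mul q rho X (a *: U + V) =
  a *: filtered_mul q rho X U + filtered_mul q rho X V.
Proof. by rewrite /filtered_mul linearPr. Qed.

Lemma filtered_mulZl q rho a X Y :
  filtered_mul q rho (a *: X) Y = a *: filtered_mul q rho X Y.
Proof. by rewrite /filtered_mul linearZl_LR. Qed.

Lemma filtered_mulZr q rho a X Y :
  filtered_mul q rho X (a *: Y) = a *: filtered_mul q rho X Y.
Proof. by rewrite /filtered_mul linearZr_LR. Qed.

Lemma W_contractionsE (V : lmodType R) (e : M -> V) (B : V -> V -> R) :
  [/\ W_scal e B = filtered_mul (fun i => B (e i) (e i)) (fun H K => H == K),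
      W_lcontr e B = filtered_mul (fun i => B (e i) (e i)) contained
    & W_rcontr e B = filtered_mul (fun i => B (e i) (e i)) containing].
Proof. by []. Qed.

End FilteredProduct.

Arguments all_pairs {d M}.
Arguments contained {d M}.
Arguments containing {d M}.
Arguments disjoint_pairs {d M}.

Opaque filtered_mul.

Ltac prove_linear := by do ?[move=> ?]; cbv beta;
  rewrite ?(filtered_mulPl, filtered_mulPr, diagonalP, grade_projP);
  rewrite ?scalerDr 1?addrACA.

Ltac multilinear := lazymatch goal with
  | |- forall _, linear _ => prove_linear
  | |- linear _ => prove_linear
  end.

Section FilteredIdentities.
Context (R : comNzRingType) (d : Order.disp_t) (M : orderType d).
Implicit Types (H J K : {fset M}) (rho : {fset M} -> {fset M} -> bool).
Local Notation W := {malg R[{fset M}]}.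
Local Notation chi := (chi R).
Local Notation reverse := (diagonal (@rev_sign R d M)).
Local Notation involute := (diagonal (@parity_sign R d M)).

Lemma chi_and (a b : bool) : chi (a && b) = chi a * chi b.
Proof. by case: a; case: b; rewrite /Defs.chi /= ?mulr1 ?mulr0. Qed.

Lemma clifford_filtered (q : M -> R) X Y :
  clifford_alg q X Y = filtered_mul q all_pairs X Y.
Proof.
apply: (bilinear_ext (f := fun X Y => lift2 (basis_mul q) X Y)
   (g := filtered_mul q all_pairs)).
- by move=> Z a U V; rewrite linearPl.
- by move=> Z a U V; rewrite linearPr.
- by move=> Z a U V; rewrite filtered_mulPl.
- by move=> Z a U V; rewrite filtered_mulPr.
by move=> H K; rewrite filtered_mulU lift2U mul1r.
Qed.

(** The vanishing form kills e_H e_K as soon as H and K meet, and otherwise the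
    form does not enter e_H e_K at all. *)
Lemma grassmann_filtered (q : M -> R) X Y :
  clifford_alg (fun=> 0) X Y = filtered_mul q disjoint_pairs X Y.
Proof.
rewrite clifford_filtered; apply: (bilinear_ext (f := filtered_mul (fun=> 0) all_pairs)
    (g := filtered_mul q disjoint_pairs)); try multilinear.
move=> H K; rewrite !filtered_mulU mul1r /sigma mulrCA.
apply: scaler_congr; congr (_ * _); rewrite /beta /disjoint_pairs.
have [->|[i iHK]] := fset_0Vmem (H `&` K); first by rewrite eqxx !big_seq_fset0 mulr1.
have /negPf -> : H `&` K != fset0 by apply/fset0Pn; exists i.
by rewrite mul0r (big_fsetD1 i) //= mul0r.
Qed.

Section FixedForm.
Context (q : M -> R).
Local Notation fmul := (filtered_mul q).
Local Notation cl := (fmul all_pairs).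

Lemma filtered_mulU_clifford rho H K :
  fmul rho << H >> << K >> = chi (rho H K) *: cl << H >> << K >>.
Proof. by rewrite !filtered_mulU mul1r scalerA. Qed.

Lemma clifford_filteredA X Y Z : cl X (cl Y Z) = cl (cl X Y) Z.
Proof. by rewrite -!clifford_filtered amulA. Qed.

Lemma filtered_mul_nestr rho rho' H J K :
  fmul rho << H >> (fmul rho' << J >> << K >>) =
  chi (rho' J K && rho H (symdiff J K)) *: cl << H >> (cl << J >> << K >>).
Proof.
rewrite [fmul rho' _ _]filtered_mulU_clifford filtered_mulZr.
rewrite (filtered_mulU _ all_pairs J).
by rewrite !filtered_mulZr filtered_mulU_clifford chi_and !scalerA mulrAC.
Qed.

Lemma filtered_mul_nestl rho rho' H J K :
  fmul rho (fmul rho' << H >> << J >>) << K >> =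
  chi (rho' H J && rho (symdiff H J) K) *: cl (cl << H >> << J >>) << K >>.
Proof.
rewrite [fmul rho' _ _]filtered_mulU_clifford filtered_mulZl.
rewrite (filtered_mulU _ all_pairs H).
by rewrite !filtered_mulZl filtered_mulU_clifford chi_and !scalerA mulrAC.
Qed.

(** Covers associativity of each product as well as laws relating two of them:
    only the Boolean side of associativity depends on the products involved. *)
Lemma filtered_mul_mixed_assoc rho1 rho2 rho3 rho4 :
  (forall H J K, rho1 H J && rho2 (symdiff H J) K =
                 rho3 J K && rho4 H (symdiff J K)) ->
  forall X Y Z, fmul rho2 (fmul rho1 X Y) Z = fmul rho4 X (fmul rho3 Y Z).
Proof.
move=> E X Y Z.
apply: (malg_linear_ext (f := fun X => fmul rho2 (fmul rho1 X Y) Z)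
  (g := fun X => fmul rho4 X (fmul rho3 Y Z))); try multilinear.
move=> H; apply: (bilinear_ext
  (f := fun Y Z => fmul rho2 (fmul rho1 << H >> Y) Z)
  (g := fun Y Z => fmul rho4 << H >> (fmul rho3 Y Z))); try multilinear.
by move=> J K; rewrite filtered_mul_nestl filtered_mul_nestr E clifford_filteredA.
Qed.

Lemma clifford_fset1_swap i K :
  cl << K >> << [fset i] >> =
  (parity_sign R K * (-1) ^+ (i \in K)) *: cl << [fset i] >> << K >>.
Proof.
rewrite !filtered_mulU scalerA symdiffC /sigma betaC alpha_fset1_swap.
by rewrite !mul1r !mulrA.
Qed.

Lemma contained_fset1 i K : contained [fset i] K = (i \in K).
Proof. by rewrite /contained fsub1set. Qed.

(** What remains of the antiderivation rule for e_i, e_H, e_K once the common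
    factor e_i e_H e_K is removed.  The sign is the one by which e_H e_i differs
    from the usual exchange rule when i occurs in H. *)
Definition derivable_pairs rho := forall i H K,
  chi (rho H K && (i \in symdiff H K)) =
  chi ((i \in H) && rho (symdiff [fset i] H) K) +
  (-1) ^+ (i \in H) * chi ((i \in K) && rho H (symdiff [fset i] K)).

(** On basis elements the three terms are multiples of e_i e_H e_K, after moving
    e_i across e_H, which produces the sign of the main automorphism. *)
Lemma lcontr_antiderivation rho : derivable_pairs rho ->
  forall i X Y, fmul contained << [fset i] >> (fmul rho X Y) =
    fmul rho (fmul contained << [fset i] >> X) Y +
    fmul rho (involute X) (fmul contained << [fset i] >> Y).
Proof.
move=> E i X Y.
apply: (bilinear_ext
 (f := fun X Y => fmul contained << [fset i] >> (fmul rho X Y))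
 (g := fun X Y => fmul rho (fmul contained << [fset i] >> X) Y +
    fmul rho (involute X)
      (fmul contained << [fset i] >> Y))); try multilinear.
move=> H K; rewrite diagonalU filtered_mulZl (filtered_mul_nestr contained).
rewrite (filtered_mul_nestr rho contained) filtered_mul_nestl.
rewrite !contained_fset1 E (clifford_filteredA << H >>) clifford_fset1_swap.
rewrite filtered_mulZl -clifford_filteredA !scalerA -scalerDl; apply: scaler_congr; congr (_ + _).
have ps : parity_sign R H * parity_sign R H = 1.
  by rewrite -expr2 sqrr_sign.
rewrite mulrC -[LHS]mulr1 -ps; ring.
Qed.

(** The relation is transposed along with the factors, which is why reversion
    exchanges the two contractions. *)
Lemma diagonal_rev_antimorphism rho X Y :
  reverse (fmul rho X Y) =
  fmul (fun H K => rho K H) (reverse Y)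
    (reverse X).
Proof.
apply: (bilinear_ext
 (f := fun X Y => reverse (fmul rho X Y))
 (g := fun X Y => fmul (fun H K => rho K H) (reverse Y)
    (reverse X))); try multilinear.
move=> H K; rewrite !diagonalU filtered_mulZl filtered_mulZr !filtered_mulU.
rewrite diagonalZ diagonalU !scalerA [symdiff K H]symdiffC /sigma [beta q K H]betaC.
apply: scaler_congr; have := rev_sign_symdiff R H K; set b := beta _ _ _ => E.
transitivity (chi (rho H K) * b * (rev_sign R (symdiff H K) * alpha R H K)).
  by ring.
by rewrite E; ring.
Qed.

Lemma diagonal_parity_morphism rho X Y :
  involute (fmul rho X Y) =
  fmul rho (involute X) (involute Y).
Proof.
apply: (bilinear_ext
 (f := fun X Y => involute (fmul rho X Y))
 (g := fun X Y => fmul rho (involute X) (involute Y)));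
  try multilinear.
move=> H K; rewrite !diagonalU filtered_mulZl filtered_mulZr !filtered_mulU.
rewrite diagonalZ diagonalU !scalerA parity_sign_symdiff.
by apply: scaler_congr; ring.
Qed.

Lemma graded_ext (L : lmodType R) (r s : int) (f g : W -> W -> L) :
  (forall Y, linear (f^~ Y)) -> (forall X, linear (f X)) ->
  (forall Y, linear (g^~ Y)) -> (forall X, linear (g X)) ->
  (forall H K, (#|` H| : int) = r -> (#|` K| : int) = s ->
     f << H >> << K >> = g << H >> << K >>) ->
  forall X Y, grade_proj r X = X -> grade_proj s Y = Y -> f X Y = g X Y.
Proof.
move=> fl fr gl gr fg X Y <- <-.
apply: (bilinear_ext (f := fun X Y => f (grade_proj r X) (grade_proj s Y))
  (g := fun X Y => g (grade_proj r X) (grade_proj s Y))).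
- by move=> Z a U V; rewrite grade_projP fl.
- by move=> Z a U V; rewrite grade_projP fr.
- by move=> Z a U V; rewrite grade_projP gl.
- by move=> Z a U V; rewrite grade_projP gr.
move=> H K; rewrite !grade_projUE /Defs.chi.
case: eqP => [Hr|_]; last first.
  by rewrite scale0r; exact: etrans (linear_map0 (fl _)) (esym (linear_map0 (gl _))).
case: eqP => [Ks|_]; last first.
  by rewrite scale0r (linear_map0 (fr _)) (linear_map0 (gr _)).
by rewrite !scale1r fg.
Qed.

Lemma filtered_mul_grade rho r H K :
  ((#|` symdiff H K| : int) == r) = rho H K ->
  fmul rho << H >> << K >> = grade_proj r (cl << H >> << K >>).
Proof.
move=> E; rewrite !filtered_mulU grade_projZ grade_projUE scalerA E mul1r.
by rewrite mulrC.
Qed.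
End FixedForm.
End FilteredIdentities.

(** * Relations on index sets and grades *)

Section Pairs.
Context (R : comNzRingType) (d : Order.disp_t) (M : orderType d).
Implicit Types (H J K : {fset M}) (r s : int).
Local Notation W := {malg R[{fset M}]}.

Lemma all_pairs_derivation : derivable_pairs R (@all_pairs d M).
Proof.
move=> i H K; rewrite in_symdiff !andbT; case: (i \in H);
  case: (i \in K); rewrite /chi /=; ring.
Qed.

(** When i lies in both H and K the two terms on the right cancel, since
    removing i from H or from K leaves the same intersection. *)
Lemma disjoint_pairs_derivation : derivable_pairs R (@disjoint_pairs d M).
Proof.
move=> i H K; rewrite in_symdiff /disjoint_pairs.
have swap : i \in H -> i \in K ->
    symdiff [fset i] H `&` K = H `&` symdiff [fset i] K.
  move=> iH iK; apply/fsetP => j; rewrite !(in_fsetI, in_symdiff, in_fset1).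
  by case: eqP => [->|_]; rewrite ?iH ?iK.
have dropl : i \notin K -> symdiff [fset i] H `&` K = H `&` K.
  move=> iK; apply/fsetP => j; rewrite !(in_fsetI, in_symdiff, in_fset1).
  by case: eqP => [->|_]; rewrite ?(negPf iK) ?andbF.
have dropr : i \notin H -> H `&` symdiff [fset i] K = H `&` K.
  move=> iH; apply/fsetP => j; rewrite !(in_fsetI, in_symdiff, in_fset1).
  by case: eqP => [->|_]; rewrite ?(negPf iH).
case: (boolP (i \in H)) => iH; case: (boolP (i \in K)) => iK /=.
- by rewrite swap // andbF /chi mulN1r; exact: esym (subrr _).
- by rewrite dropl // andbT /chi /= mulr0 addr0.
- by rewrite dropr // andbT /chi /= add0r mul1r.
- by rewrite andbF /chi mulr0 addr0.
Qed.

Lemma disjoint_contained H J K :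
  disjoint_pairs H J && contained (symdiff H J) K =
  contained J K && contained H (symdiff J K).
Proof.
rewrite /disjoint_pairs /contained -/(fdisjoint H J).
apply/andP/andP => -[].
  move=> /fdisjointP HJ /fsubsetP sK; split; apply/fsubsetP => j jX.
    apply: sK; rewrite in_symdiff jX addbT.
    by apply/negP => /HJ; rewrite jX.
  by rewrite in_symdiff (negPf (HJ j jX)) sK // in_symdiff jX (negPf (HJ j jX)).
move=> /fsubsetP JK /fsubsetP HJK.
have HJ j : j \in H -> j \notin J.
  move=> jH; have := HJK j jH; rewrite in_symdiff.
  by apply: contraL => jJ; rewrite jJ JK.
split; first exact/fdisjointP.
apply/fsubsetP => j; rewrite in_symdiff.
case: (boolP (j \in H)) => [jH _|_]; last exact: JK.
by have := HJK j jH; rewrite in_symdiff (negPf (HJ j jH)).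
Qed.

(** The summand of grade t of the Clifford product of homogeneous elements is the restricted
    product for the relation that detects #(H + K) = t; it remains to compute
    #(H + K) for each relation, which the next lemmas do. *)
Lemma graded_restrict q rho r s t :
  (forall H K, (#|` H| : int) = r -> (#|` K| : int) = s ->
     ((#|` symdiff H K| : int) == t) = rho H K) ->
  forall X Y : W, grade_proj r X = X -> grade_proj s Y = Y ->
  filtered_mul q rho X Y = grade_proj t (filtered_mul q all_pairs X Y).
Proof.
move=> E X Y; apply: (graded_ext (f := filtered_mul q rho)
  (g := fun X Y => grade_proj t (filtered_mul q all_pairs X Y)));
  try multilinear.
by move=> H K Hr Ks; apply: filtered_mul_grade; exact: E.
Qed.

Lemma disjoint_card r s H K : (#|` H| : int) = r -> (#|` K| : int) = s ->
  ((#|` symdiff H K| : int) == r + s) = disjoint_pairs H K.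
Proof.
move=> <- <-; rewrite /disjoint_pairs -cardfs_eq0.
by have := cardfs_symdiff H K; lia.
Qed.

Lemma contained_card r s H K : (#|` H| : int) = r -> (#|` K| : int) = s ->
  ((#|` symdiff H K| : int) == s - r) = contained H K.
Proof.
move=> <- <-; rewrite /contained fsubset_cardsI.
by have := cardfs_symdiff H K; lia.
Qed.

Lemma containing_card r s H K : (#|` H| : int) = r -> (#|` K| : int) = s ->
  ((#|` symdiff H K| : int) == r - s) = containing H K.
Proof.
move=> Hr Ks; rewrite symdiffC; exact: contained_card.
Qed.

Lemma eq_pairs_card H K : ((#|` symdiff H K| : int) == 0) = (H == K).
Proof.
rewrite eqz_nat cardfs_eq0; apply/eqP/eqP => [E|->].
  by rewrite -[K](symdiffK H) E; apply/fsetP => i; rewrite in_symdiff inE addbF.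
by apply/fsetP => i; rewrite in_symdiff addbb.
Qed.

Lemma scalar_grade0 q (X Y : W) :
  filtered_mul q (fun H K => H == K) X Y =
  grade_proj 0 (filtered_mul q all_pairs X Y).
Proof.
apply: (bilinear_ext (f := filtered_mul q (fun H K => H == K))
  (g := fun X Y => grade_proj 0 (filtered_mul q all_pairs X Y)));
  try multilinear.
by move=> H K; apply: filtered_mul_grade; exact: eq_pairs_card.
Qed.

Definition product_grade r s (i : nat) : bool :=
  (`|r - s| <= i%:Z <= r + s) && (2 %| i%:Z - `|r - s|)%Z.

(** The grade of e_H e_K is r + s - 2 #(H meet K), and #(H meet K) ranges
    from 0 to the smaller of r and s. *)
Lemma clifford_grade_sum q r s (X Y : W) :
  grade_proj r X = X -> grade_proj s Y = Y ->
  filtered_mul q all_pairs X Y =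
  \sum_(0 <= i < (absz (r + s)).+1 | product_grade r s i)
     grade_proj i%:Z (filtered_mul q all_pairs X Y).
Proof.
set n := _.+1.
apply: (graded_ext (f := filtered_mul q all_pairs) (g := fun X Y =>
  \sum_(0 <= i < n | product_grade r s i)
    grade_proj i%:Z (filtered_mul q all_pairs X Y)));
  try multilinear.
- move=> Z a U T; rewrite scaler_sumr -big_split; apply: eq_bigr => i _ /=.
  by rewrite filtered_mulPl grade_projP.
- move=> Z a U T; rewrite scaler_sumr -big_split; apply: eq_bigr => i _ /=.
  by rewrite filtered_mulPr grade_projP.
move=> H K Hr Ks; have cHK := cardfs_symdiff H K.
have cH := fsubset_leq_card (fsubsetIl H K).
have cK := fsubset_leq_card (fsubsetIr H K).
under eq_bigr => i _ do rewrite filtered_mulU grade_projZ grade_projUE.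
rewrite (big_nat_only (m := #|` symdiff H K|)) /n; last 3 first.
- by lia.
- by rewrite /product_grade -Hr -Ks; lia.
- by move=> i iHK; rewrite eqz_nat eq_sym (negPf iHK) /chi scale0r scaler0.
by rewrite filtered_mulU {2}/chi eqxx scale1r.
Qed.

Lemma homogeneous_rev r (X : W) : grade_proj r X = X ->
  diagonal (@rev_sign R d M) X = (-1) ^+ absz (r * (r - 1) %/ 2)%Z *: X.
Proof.
move=> E; apply/malgP => K; rewrite mcoeffZ mcoeff_diagonal.
have := mcoeff_grade_proj r X K; rewrite E.
case: eqP => [Kr _|_ ->]; last by rewrite !mulr0.
congr (_ * _); rewrite rev_signE -Kr; congr (_ ^+ _).
rewrite bin2; case: #|` K| => // n.
have -> : (n.+1%:Z - 1 = n)%R by lia.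
by rewrite -PoszM divz_nat absz_nat divn2.
Qed.
End Pairs.

(** * The structure of a geometric algebra *)

Section Transport.
Context (R : comNzRingType) (d : Order.disp_t) (M : orderType d).
Context (V : lmodType R) (e : M -> V) (B : V -> V -> R) (e_basis : is_basis e).
Context (G : geometric_algebra e B).
Local Notation W := {malg R[{fset M}]}.
Local Notation phi := (ga_iso G).
Local Notation psi := (@ga_inv _ _ _ _ _ _ G).
Local Notation v := (ga_emb G).
Local Notation q := (fun i => B (e i) (e i)).
Local Notation reverse := (diagonal (@rev_sign R d M)).
Local Notation involute := (diagonal (@parity_sign R d M)).
Implicit Types (X Y Z : W) (x y : V).
Implicit Types (H K : {fset M}) (rho : {fset M} -> {fset M} -> bool).

Lemma ga_inv_linear : linear psi.
Proof.
move=> a X Y; apply: (can_inj (@ga_isoK _ _ _ _ _ _ G)).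
by rewrite linearP !ga_invK.
Qed.

Lemma ga_clE X Y : ga_cl G (phi X) (phi Y) = phi (filtered_mul q all_pairs X Y).
Proof. by rewrite -ga_iso_cl -clifford_filtered. Qed.

Lemma ga_grE X Y : ga_gr G (phi X) (phi Y) = phi (filtered_mul q disjoint_pairs X Y).
Proof. by rewrite -ga_iso_gr -grassmann_filtered. Qed.

Lemma ga_scalE X Y :
  phi X \sp phi Y = phi (filtered_mul q (fun H K => H == K) X Y).
Proof.
by rewrite /ga_scal /ga_transport !ga_isoK; have [-> _ _] := W_contractionsE e B.
Qed.

Lemma ga_lcontrE X Y : phi X \lc phi Y = phi (filtered_mul q contained X Y).
Proof.
by rewrite /ga_lcontr /ga_transport !ga_isoK; have [_ -> _] := W_contractionsE e B.
Qed.

Lemma ga_rcontrE X Y : phi X \rc phi Y = phi (filtered_mul q containing X Y).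
Proof.
by rewrite /ga_rcontr /ga_transport !ga_isoK; have [_ _ ->] := W_contractionsE e B.
Qed.

Lemma ga_one_cl : aone (ga_cl G) = phi << fset0 >>.
Proof.
rewrite -[RHS](amul1X (ga_cl G)) -[aone _ in RHS]ga_invK -ga_iso_cl.
by rewrite (amulX1 (W_alg e B)) ga_invK.
Qed.

Lemma ga_one_gr : aone (ga_gr G) = phi << fset0 >>.
Proof.
rewrite -[RHS](amul1X (ga_gr G)) -[aone _ in RHS]ga_invK -ga_iso_gr.
by rewrite (amulX1 (W_alg e (fun _ _ => 0))) ga_invK.
Qed.

Lemma malgU_fset1U rho i K : rho [fset i] K -> i \notin K ->
  << i |` K >> =
  alpha R [fset i] K *: filtered_mul q rho << [fset i] >> << K >>.
Proof.
move=> rhoiK iK; rewrite filtered_mulU rhoiK /chi mul1r scalerA.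
rewrite symdiff_fset1 //.
rewrite /sigma mulrA alpha_sqr mul1r /beta.
have -> : [fset i] `&` K = fset0.
  apply/fsetP => j; rewrite !inE; apply/negP => /andP[/eqP-> ].
  by rewrite (negPf iK).
by rewrite big_seq_fset0 scale1r.
Qed.

(** Under this condition every e_K is, up to sign, a product of vectors for the
    product attached to rho. *)
Definition generating rho := forall i K, i \notin K -> rho [fset i] K.

Lemma generating_all : generating all_pairs.
Proof. by []. Qed.

Lemma generating_disjoint : generating disjoint_pairs.
Proof.
move=> i K iK; apply/eqP/fsetP => j; rewrite !inE; apply/negP => /andP[/eqP-> ].
by rewrite (negPf iK).
Qed.

(** An element of W is built from the unit by multiplying by vectors on the left,
    adding and scaling; this gives uniqueness of the reversions and of the main
    automorphism, which all satisfy a rule for f (A (v x) X). *)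
Lemma generated_ext (A : algebra_on G) rho (f g : G -> G) : generating rho ->
  (forall X Y, A (phi X) (phi Y) = phi (filtered_mul q rho X Y)) ->
  linear f -> linear g -> f (phi << fset0 >>) = g (phi << fset0 >>) ->
  (forall x (X : G), f X = g X -> f (A (v x) X) = g (A (v x) X)) -> f =1 g.
Proof.
move=> gen AE linf ling fg1 fgM X; rewrite -(ga_invK X); move: (psi X) => {X} X.
apply: (malg_linear_ext (f := f \o phi) (g := g \o phi)) => [a U Z|a U Z|K].
- by rewrite /= linearP linf.
- by rewrite /= linearP ling.
have [n] := ubnP #|` K|; elim: n K => // n IHn K.
have [->|[i iK]] := fset_0Vmem K; first by [].
rewrite -(fsetD1K iK); set L := K `\ i; have iL : i \notin L by rewrite !inE eqxx.
rewrite cardfsU1 iL add1n ltnS => /IHn {}IHn /=.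
rewrite (malgU_fset1U (gen i L iL) iL) linearZ_LR -AE ga_isoV.
by rewrite (linear_mapZ _ _ linf) (linear_mapZ _ _ ling) fgM.
Qed.

Lemma ga_inv_emb i : psi (v (e i)) = << [fset i] >>.
Proof. by rewrite -ga_isoV ga_isoK. Qed.

Lemma diagonal_emb (f : {fset M} -> R) (a : R) x : (forall i, f [fset i] = a) ->
  diagonal f (psi (v x)) = a *: psi (v x).
Proof.
move=> fa; apply: (basis_linear_ext e_basis (f := fun x => diagonal f (psi (v x)))
   (g := fun x => a *: psi (v x))) => [b y z|b y z|i].
- by rewrite linearP ga_inv_linear diagonalP.
- by rewrite linearP ga_inv_linear scalerDr !scalerA mulrC.
by rewrite ga_inv_emb diagonalU fa.
Qed.

Lemma rev_sign_fset1 (i : M) : rev_sign R ([fset i] : {fset M}) = 1.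
Proof. by rewrite rev_signE cardfs1. Qed.

Lemma rev_sign_fset0 : rev_sign R (fset0 : {fset M}) = 1.
Proof. by rewrite rev_signE cardfs0. Qed.

(** Symmetry of rho turns the antimorphism property on W, which transposes the
    relation, into one for the product A. *)
Lemma reversionE (A : algebra_on G) rho : generating rho ->
  (forall H K, rho H K = rho K H) ->
  (forall X Y, A (phi X) (phi Y) = phi (filtered_mul q rho X Y)) ->
  aone A = phi << fset0 >> ->
  forall X, reversion A (phi X) = phi (reverse X).
Proof.
move=> gen rhoC AE A1 X.
pose F (T : G) : G := phi (reverse (psi T)).
have FP : is_reversion A F.
  split=> [a T U||x|T U].
  - by rewrite /F ga_inv_linear diagonalP linearP.
  - by rewrite A1 /F ga_isoK diagonalU rev_sign_fset0 scale1r.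
  - by rewrite /F (diagonal_emb _ rev_sign_fset1) scale1r ga_invK.
  rewrite -(ga_invK T) -(ga_invK U) AE /F !ga_isoK AE diagonal_rev_antimorphism.
  apply: (congr1 phi).
  apply: (bilinear_ext (f := filtered_mul q (fun H K => rho K H))
    (g := filtered_mul q rho)); try multilinear.
  by move=> H K; rewrite !filtered_mulU rhoC.
have [linr r1 rV rM] : is_reversion A (reversion A).
  exact: (epsilon_spec (inhabits id) (is_reversion A) (ex_intro _ F FP)).
have [linF F1 FV FM] := FP.
have -> : reversion A (phi X) = F (phi X).
  apply: (generated_ext gen AE linr linF) => [|x Z E]; first by rewrite -A1 r1 F1.
  by rewrite rM FM rV FV E.
by rewrite /F ga_isoK.
Qed.

Lemma ga_reversion_cl X :
  reversion (ga_cl G) (phi X) = phi (reverse X).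
Proof. exact: (reversionE generating_all (fun _ _ => erefl) ga_clE ga_one_cl). Qed.

Lemma ga_reversion_gr X :
  reversion (ga_gr G) (phi X) = phi (reverse X).
Proof.
apply: (reversionE generating_disjoint _ ga_grE ga_one_gr) => H K.
by rewrite /disjoint_pairs fsetIC.
Qed.

Lemma ga_main_automorphismE X :
  main_automorphism G (phi X) = phi (involute X).
Proof.
pose F (T : G) : G := phi (involute (psi T)).
have FP : is_main_automorphism F.
  split=> [a T U||T U|x].
  - by rewrite /F ga_inv_linear diagonalP linearP.
  - by rewrite ga_one_cl /F ga_isoK diagonalU /parity_sign cardfs0 scale1r.
  - rewrite -(ga_invK T) -(ga_invK U) ga_clE /F !ga_isoK ga_clE.
    by rewrite diagonal_parity_morphism.
  - rewrite /F (diagonal_emb (a := -1)) => [|i]; last by rewrite /parity_sign cardfs1.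
    by rewrite scaleN1r raddfN /= ga_invK.
have [linr r1 rM rV] : is_main_automorphism (main_automorphism G).
  exact: (epsilon_spec (inhabits id) (@is_main_automorphism _ _ _ _ _ _ G)
    (ex_intro _ F FP)).
have [linF F1 FM FV] := FP.
have -> : main_automorphism G (phi X) = F (phi X).
  apply: (generated_ext generating_all ga_clE linr linF) => [|x Z E].
    by rewrite -ga_one_cl r1 F1.
  by rewrite rM FM rV FV E.
by rewrite /F ga_isoK.
Qed.

Lemma wedge_homogeneous n (a : 'I_n -> V) :
  grade_proj n (psi (\big[ga_wedge G/aone (ga_gr G)]_(i < n) v (a i))) =
  psi (\big[ga_wedge G/aone (ga_gr G)]_(i < n) v (a i)).
Proof.
elim: n a => [|n IHn] a.
  by rewrite big_ord0 ga_one_gr ga_isoK grade_projU // cardfs0.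
rewrite big_ord_recl; move: (IHn (fun i => a (lift ord0 i))).
move: (\big[_/_]_(i < n) _) => P hP.
rewrite -(ga_invK (v (a ord0))) -(ga_invK P) /ga_wedge ga_grE ga_isoK.
have ha : grade_proj 1 (psi (v (a ord0))) = psi (v (a ord0)).
  rewrite grade_proj_diagonal (diagonal_emb (a := 1)) ?scale1r // => i.
  by rewrite cardfs1 /chi eqxx.
apply: (graded_ext (r := 1) (s := n) (f := fun X Y =>
   grade_proj n.+1 (filtered_mul q disjoint_pairs X Y))
   (g := filtered_mul q disjoint_pairs)) ha hP; try multilinear.
move=> H K H1 Kn; rewrite filtered_mulU grade_projZ grade_projUE.
rewrite !scalerA /disjoint_pairs /chi -cardfs_eq0.
have := cardfs_symdiff H K; case: eqP => [E|_] E'; last by rewrite !mul0r.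
by rewrite (_ : _ == _) ?mulr1 //; lia.
Qed.

(** The sign of e_K against the product of its vectors is absorbed in the first
    factor, so that e_K is itself a product of n vectors. *)
Lemma malgU_wedge n K : #|` K| = n -> exists a : 'I_n -> V,
  phi << K >> = \big[ga_wedge G/aone (ga_gr G)]_(i < n) v (a i).
Proof.
elim: n K => [|n IHn] K.
  move/eqP; rewrite cardfs_eq0 => /eqP ->.
  by exists (fun=> 0); rewrite big_ord0 ga_one_gr.
have [->|[i iK]] := fset_0Vmem K; first by rewrite cardfs0.
rewrite -(fsetD1K iK); set L := K `\ i; have iL : i \notin L by rewrite !inE eqxx.
rewrite cardfsU1 iL add1n => -[/IHn [a aL]].
exists (fun j => if unlift ord0 j is Some k then a k else alpha R [fset i] L *: e i).
rewrite big_ord_recl unlift_none; under eq_bigr => k _ do rewrite liftK.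
rewrite -aL /ga_wedge linearZ_LR linearZl_LR -ga_isoV ga_grE -linearZ_LR.
by rewrite (malgU_fset1U (generating_disjoint iL) iL).
Qed.

(** A product of r vectors only involves e_K with #K = r, and each such e_K is
    itself a product of r vectors; for negative r both sides say X = 0. *)
Lemma has_gradeE (r : int) X : has_grade r (phi X) <-> grade_proj r X = X.
Proof.
case: r => n /=; last first.
  have E : grade_proj (Negz n) X = 0.
    by apply/malgP => K; rewrite mcoeff_grade_proj mcoeff0.
  rewrite E; split=> [h|<-]; last exact: linear0.
  by apply: (can_inj (@ga_isoK _ _ _ _ _ _ G)); rewrite h linear0.
split=> [|E].
  move=> S; rewrite -[X](@ga_isoK _ _ _ _ _ _ G).
  apply: (lin_span_ext (f := fun T => grade_proj n (psi T)) (g := psi)) S.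
  - by move=> a T U; rewrite ga_inv_linear grade_projP.
  - exact: ga_inv_linear.
  - by move=> T [a ->]; exact: wedge_homogeneous.
rewrite [X]malg_expansion linear_sum /=.
under eq_bigr => K _ do rewrite linearZ_LR.
apply: lin_span_sum => K KX _; apply: malgU_wedge; apply/eqP.
have := mcoeff_grade_proj n X K; rewrite E eqz_nat; case: ifP => // _ XK.
by rewrite -mcoeff_neq0 XK eqxx in KX.
Qed.

(** The epsilon in gproj picks some homogeneous component; applying the
    coordinate projection to the defining property shows that there is only
    one. *)
Lemma gprojE (r : int) X : gproj r (phi X) = phi (grade_proj r X).
Proof.
have P : is_gproj r (phi X) (phi (grade_proj r X)).
  split; first by apply/has_gradeE; rewrite grade_projK.
  have E : X - grade_proj r X =
    \sum_(K <- msupp X | (#|` K| : int) != r) X@_K *: << K >>.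
    rewrite {1}[X]malg_expansion grade_proj_diagonal diagonalE -sumrB [RHS]big_mkcond.
    apply: eq_bigr => K _; rewrite /chi.
    case: (_ =P _) => _ /=; first by rewrite mul1r; exact: subrr.
    by rewrite mul0r scale0r; exact: subr0.
  rewrite -linearB E linear_sum /=.
  under eq_bigr => K _ do rewrite linearZ_LR.
  apply: lin_span_sum => K _ Kr; exists (#|` K| : int) => //.
  by apply/has_gradeE; rewrite grade_projU.
have [g1 S] : is_gproj r (phi X) (gproj r (phi X)).
  exact: (epsilon_spec (inhabits 0) (is_gproj r (phi X)) (ex_intro _ _ P)).
move: g1 S; rewrite -(ga_invK (gproj r (phi X))); move: (psi _) => Y.
move=> /has_gradeE hY S; rewrite -hY; apply: (congr1 phi).
have : grade_proj r (psi (phi X - phi Y)) = 0.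
  apply: (lin_span_ext (f := fun T => grade_proj r (psi T)) (g := fun=> 0)) S.
  - by move=> a T U; rewrite ga_inv_linear grade_projP.
  - by move=> a T U; rewrite scaler0 addr0.
  - move=> T [i ir]; rewrite -(ga_invK T) => /has_gradeE hT.
    by rewrite ga_isoK; apply: grade_proj_disjoint hT; rewrite eq_sym.
rewrite -(linearB phi) ga_isoK grade_projB => /subr0_eq E.
exact: esym E.
Qed.

End Transport.

(** * Contraction by vectors *)

Section Identities.
Context (R : comNzRingType) (d : Order.disp_t) (M : orderType d).
Context (V : lmodType R) (e : M -> V) (B : {biscalar V}) (e_basis : is_basis e).
Context (B_diag : forall i j : M, i != j -> B (e i) (e j) = 0).
Context (G : geometric_algebra e B).
Local Notation W := {malg R[{fset M}]}.
Local Notation phi := (ga_iso G).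
Local Notation psi := (@ga_inv _ _ _ _ _ _ G).
Local Notation v := (ga_emb G).
Local Notation q := (fun i => B (e i) (e i)).
Implicit Types (x y : V).

(** Inclusion and disjointness are complementary when H is a singleton. *)
Lemma clifford_split x (X : G) : v x \cl X = v x \wg X + v x \lc X.
Proof.
rewrite -(ga_invK X) -(ga_invK (v x)) /ga_clmul /ga_wedge.
rewrite ga_clE ga_grE ga_lcontrE -linearD; apply: (congr1 phi).
move: (psi X) => {}X.
apply: (basis_linear_ext e_basis
  (f := fun x => filtered_mul q all_pairs (psi (v x)) X)
  (g := fun x => filtered_mul q disjoint_pairs (psi (v x)) X +
     filtered_mul q contained (psi (v x)) X)) => [a y z|a y z|i].
- by rewrite linearP ga_inv_linear filtered_mulPl.
- by rewrite linearP ga_inv_linear !filtered_mulPl scalerDr addrACA.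
rewrite ga_inv_emb; apply: (malg_linear_ext
  (f := filtered_mul q all_pairs << [fset i] >>)
  (g := fun X => filtered_mul q disjoint_pairs << [fset i] >> X +
     filtered_mul q contained << [fset i] >> X)); try multilinear.
move=> K; rewrite !filtered_mulU -scalerDl -mulrDl; apply: scaler_congr.
congr (_ * _); rewrite contained_fset1 /disjoint_pairs /chi /=.
case: (boolP (i \in K)) => iK.
  have /negPf -> : [fset i] `&` K != fset0.
    by apply/fset0Pn; exists i; rewrite in_fsetI in_fset1 eqxx.
  by rewrite add0r.
by rewrite [_ == _](generating_disjoint iK) addr0.
Qed.

Lemma lcontr_derivation (A : algebra_on G) (rho : {fset M} -> {fset M} -> bool) :
  (forall X Y : W, A (phi X) (phi Y) = phi (filtered_mul q rho X Y)) ->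
  derivable_pairs R rho ->
  forall x (X Y : G), v x \lc A X Y =
    A (v x \lc X) Y + A (main_automorphism G X) (v x \lc Y).
Proof.
move=> AE E x X Y; rewrite -(ga_invK X) -(ga_invK Y) -(ga_invK (v x)).
rewrite (ga_main_automorphismE e_basis) AE !ga_lcontrE !AE -linearD.
apply: (congr1 phi); move: (psi X) (psi Y) => {}X {}Y.
apply: (basis_linear_ext e_basis
  (f := fun x => filtered_mul q contained (psi (v x)) (filtered_mul q rho X Y))
  (g := fun x => filtered_mul q rho (filtered_mul q contained (psi (v x)) X) Y +
     filtered_mul q rho (diagonal (@parity_sign R d M) X)
        (filtered_mul q contained (psi (v x)) Y))) => [a y z|a y z|i].
- by rewrite linearP ga_inv_linear filtered_mulPl.
- rewrite linearP ga_inv_linear !filtered_mulPl filtered_mulPr.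
  by rewrite scalerDr addrACA.
by rewrite ga_inv_emb; exact: lcontr_antiderivation.
Qed.

Lemma lcontr_vectors x y : v x \lc v y = B x y *: aone (ga_gr G).
Proof.
rewrite -(ga_invK (v x)) -(ga_invK (v y)) ga_lcontrE ga_one_gr -linearZ_LR.
apply: (congr1 phi).
apply: (basis_linear_ext e_basis
  (f := fun x => filtered_mul q contained (psi (v x)) (psi (v y)))
  (g := fun x => B x y *: << fset0 >>)) => [a z t|a z t|i].
- by rewrite linearP ga_inv_linear filtered_mulPl.
- by rewrite linearPl scalerDl scalerA.
apply: (basis_linear_ext e_basis
  (f := fun y => filtered_mul q contained (psi (v (e i))) (psi (v y)))
  (g := fun y => B (e i) y *: << fset0 >>)) => [a z t|a z t|j].
- by rewrite linearP ga_inv_linear filtered_mulPr.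
- by rewrite linearPr scalerDl scalerA.
rewrite !ga_inv_emb filtered_mulU contained_fset1 in_fset1 /chi.
case: eqP => [<-|/eqP ij]; last first.
  rewrite (B_diag ij) mul0r scale0r; exact: esym (scale0r _).
have -> : symdiff [fset i] [fset i] = fset0.
  by apply/fsetP => k; rewrite in_symdiff addbb.
apply: scaler_congr; rewrite mul1r /sigma /alpha /beta fsetIid !big_seq_fset1.
by rewrite big_mkcond big_seq_fset1 ltxx mul1r.
Qed.

Lemma lcontr_one x : v x \lc phi << fset0 >> = 0.
Proof.
rewrite -(ga_invK (v x)) ga_lcontrE -[RHS](linear0 phi); apply: (congr1 phi).
apply: (basis_linear_ext e_basis
  (f := fun x => filtered_mul q contained (psi (v x)) << fset0 >>)
  (g := fun x => 0)) => [a z t|a z t|i].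
- by rewrite linearP ga_inv_linear filtered_mulPl.
- by rewrite scaler0 addr0.
by rewrite ga_inv_emb filtered_mulU contained_fset1 in_fset0 /chi mul0r scale0r.
Qed.

Lemma main_automorphism_vector x : main_automorphism G (v x) = - v x.
Proof.
rewrite -(ga_invK (v x)) (ga_main_automorphismE e_basis).
rewrite (diagonal_emb e_basis G (a := -1)) => [|i]; last by rewrite /parity_sign cardfs1.
by rewrite scaleN1r linearN.
Qed.

(* Both algebras satisfy the two hypotheses, hence the next results hold for the
   Clifford and for the outer product. *)
Section VectorProducts.
Context (A : algebra_on G) (A1 : aone A = phi << fset0 >>).
Context (derA : forall x (X Y : G), v x \lc A X Y =
    A (v x \lc X) Y + A (main_automorphism G X) (v x \lc Y)).

Lemma lcontr_product p x (xs : 'I_p -> V) :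
  v x \lc (\big[A/aone A]_(i < p) v (xs i)) =
  \sum_(k < p) (-1) ^+ k *:
     \big[A/aone A]_(i < p) (if i == k then v x \lc v (xs i) else v (xs i)).
Proof.
elim: p xs => [|p IHp] xs; first by rewrite !big_ord0 A1 lcontr_one.
rewrite big_ord_recl derA IHp main_automorphism_vector [RHS]big_ord_recl.
rewrite expr0 scale1r big_ord_recl eqxx; congr (_ + _).
rewrite linear_sumr; apply: eq_bigr => k _.
rewrite big_ord_recl linearZr_LR linearNl -scaleN1r scalerA.
by rewrite lift0 exprSr.
Qed.

Lemma lcontr_product_orthogonal p x (xs : 'I_p -> V) : (forall i, B x (xs i) = 0) ->
  v x \lc (\big[A/aone A]_(i < p) v (xs i)) = 0.
Proof.
elim: p xs => [|p IHp] xs xxs; first by rewrite big_ord0 A1 lcontr_one.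
rewrite big_ord_recl derA IHp // lcontr_vectors xxs scale0r.
by rewrite linear0l linear0r addr0.
Qed.
End VectorProducts.

(** The contraction in x_1 (x_2 ... x_p) = x_1 ^ (x_2 ... x_p) +
    x_1 _| (x_2 ... x_p) vanishes by orthogonality. *)
Lemma orthogonal_product p (xs : 'I_p -> V) :
  (forall i j : 'I_p, i != j -> B (xs i) (xs j) = 0) ->
  \big[ga_clmul G/aone (ga_cl G)]_(i < p) v (xs i) =
  \big[ga_wedge G/aone (ga_gr G)]_(i < p) v (xs i).
Proof.
elim: p xs => [|p IHp] xs xs0; first by rewrite !big_ord0 ga_one_cl ga_one_gr.
rewrite big_ord_recl clifford_split.
rewrite (lcontr_product_orthogonal (A := ga_cl G) (ga_one_cl G)
  (lcontr_derivation (ga_clE G) (@all_pairs_derivation R d M))); last first.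
  by move=> i; apply: xs0; rewrite neq_lift.
rewrite addr0 [RHS]big_ord_recl IHp // => i j ij.
by apply: xs0; rewrite (inj_eq lift_inj).
Qed.
End Identities.

Theorem theorem3 (R : comNzRingType) (d : Order.disp_t) (M : orderType d)
    (V : lmodType R) (e : M -> V) (B : {biscalar V})
    (V_neq0 : exists v : V, v != 0)
    (e_basis : is_basis e)
    (B_diag : forall i j : M, i != j -> B (e i) (e j) = 0)
    (G : geometric_algebra e B) :
  let v : V -> G := ga_emb G in
  let one_cl : G := aone (ga_cl G) in
  let one_gr : G := aone (ga_gr G) in
  let rev : G -> G := reversion (ga_cl G) in
  let hat : G -> G := main_automorphism G in
  (* 1 *)
  (one_cl = one_gr /\
   forall (x : V) (X : G), v x \cl X = v x \wg X + v x \lc X) /\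
  (* 2 *)
  ((forall X : G, reversion (ga_cl G) X = reversion (ga_gr G) X) /\
   forall (r : int) (X : G), has_grade r X ->
     rev X = (-1) ^+ absz (r * (r - 1) %/ 2)%Z *: X) /\
  (* 3a *)
  ((forall X Y : G, rev (X \rc Y) = rev Y \lc rev X) /\
   (forall X Y : G, X \sp Y = gproj 0 (X \cl Y)) /\
   forall (r s : int) (X Y : G), has_grade r X -> has_grade s Y ->
     X \wg Y = gproj (r + s) (X \cl Y)) /\
  (* 3b *)
  (forall (r s : int) (X Y : G), has_grade r X -> has_grade s Y ->
     X \lc Y = gproj (s - r) (X \cl Y) /\
     X \rc Y = gproj (r - s) (X \cl Y) /\
     X \cl Y = \sum_(0 <= i < (absz (r + s)).+1
                    | (`|r - s| <= i%:Z <= r + s) && (2 %| i%:Z - `|r - s|)%Z)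
                 gproj i%:Z (X \cl Y)) /\
  (* 4 *)
  (forall X Y Z : G, (X \wg Y) \lc Z = X \lc (Y \lc Z)) /\
  (* 5 *)
  ((forall x y : V, v x \lc v y = B x y *: one_gr) /\
   forall (x : V) (X Y : G),
     v x \lc (X \cl Y) = (v x \lc X) \cl Y + hat X \cl (v x \lc Y)) /\
  (* 6 *)
  ((forall x y : V, v x \lc v y = B x y *: one_gr) /\
   forall (x : V) (X Y : G),
     v x \lc (X \wg Y) = (v x \lc X) \wg Y + hat X \wg (v x \lc Y)) /\
  (* 7 *)
  (forall (p : nat) (x : V) (xs : 'I_p -> V), (1 <= p)%N ->
     v x \lc (\big[ga_clmul G/one_cl]_(i < p) v (xs i)) =
     \sum_(k < p) (-1) ^+ k *:
       \big[ga_clmul G/one_cl]_(i < p)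
          (if i == k then v x \lc v (xs i) else v (xs i))) /\
  (* 8 *)
  (forall (p : nat) (x : V) (xs : 'I_p -> V), (1 <= p)%N ->
     v x \lc (\big[ga_wedge G/one_gr]_(i < p) v (xs i)) =
     \sum_(k < p) (-1) ^+ k *:
       \big[ga_wedge G/one_gr]_(i < p)
          (if i == k then v x \lc v (xs i) else v (xs i))) /\
  (* 9 *)
  (forall (p : nat) (xs : 'I_p -> V), (1 <= p)%N ->
     (forall i j : 'I_p, i != j -> B (xs i) (xs j) = 0) ->
     \big[ga_clmul G/one_cl]_(i < p) v (xs i) =
     \big[ga_wedge G/one_gr]_(i < p) v (xs i)).
Proof.
move=> v one_cl one_gr rev hat.
have dcl := lcontr_derivation e_basis (ga_clE G) (@all_pairs_derivation R d M).
have dgr := lcontr_derivation e_basis (ga_grE G) (@disjoint_pairs_derivation R d M).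
have one : one_cl = one_gr by rewrite /one_cl /one_gr ga_one_cl ga_one_gr.
have lin := lcontr_vectors e_basis B_diag G.
(* The outer product and both contractions of homogeneous elements are instances,
   for the relation that holds exactly when e_H e_K has grade t. *)
have gproj_restrict (r s t : int) (rho : {fset M} -> {fset M} -> bool) (X Y : G) :
  (forall H K : {fset M}, (#|` H| : int) = r -> (#|` K| : int) = s ->
     ((#|` symdiff H K| : int) == t) = rho H K) ->
  has_grade r X -> has_grade s Y ->
  ga_iso G (filtered_mul (fun i => B (e i) (e i)) rho (ga_inv X) (ga_inv Y)) =
  gproj t (X \cl Y).
  rewrite -(ga_invK X) -(ga_invK Y) => E.
  move=> /(has_gradeE e_basis) hX /(has_gradeE e_basis) hY.
  rewrite /ga_clmul ga_clE (gprojE e_basis) !ga_isoK.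
  by apply: (congr1 (ga_iso G)); apply: graded_restrict hX hY.
split; [|split; [|split; [|split; [|split; [|split; [|split; [|split; [|split]]]]]]]].
- by split=> // x X; exact: clifford_split.
- split=> [X|r X]; rewrite -(ga_invK X).
    by rewrite (ga_reversion_cl e_basis) (ga_reversion_gr e_basis).
  move=> /(has_gradeE e_basis) hX; rewrite /rev (ga_reversion_cl e_basis) -linearZ_LR.
  by apply: (congr1 (ga_iso G)); exact: homogeneous_rev.
- split; [|split] => [X Y|X Y|r s X Y hX hY].
  + rewrite -(ga_invK X) -(ga_invK Y) ga_rcontrE /rev !(ga_reversion_cl e_basis).
    rewrite ga_lcontrE; apply: (congr1 (ga_iso G)).
    exact: diagonal_rev_antimorphism.
  + rewrite -(ga_invK X) -(ga_invK Y) ga_scalE /ga_clmul ga_clE (gprojE e_basis).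
    by apply: (congr1 (ga_iso G)); exact: scalar_grade0.
  + rewrite -(gproj_restrict _ _ _ _ _ _ (@disjoint_card d M r s) hX hY).
    by rewrite -ga_grE !ga_invK.
- move=> r s X Y hX hY; split; [|split].
  + rewrite -(gproj_restrict _ _ _ _ _ _ (@contained_card d M r s) hX hY).
    by rewrite -ga_lcontrE !ga_invK.
  + rewrite -(gproj_restrict _ _ _ _ _ _ (@containing_card d M r s) hX hY).
    rewrite -ga_rcontrE (ga_invK X) (ga_invK Y); reflexivity.
  move: hX hY; rewrite -(ga_invK X) -(ga_invK Y).
  move=> /(has_gradeE e_basis) hX /(has_gradeE e_basis) hY.
  rewrite /ga_clmul ga_clE {1}(clifford_grade_sum _ hX hY) linear_sum.
  by apply: eq_bigr => i _; rewrite (gprojE e_basis).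
- move=> X Y Z; rewrite -(ga_invK X) -(ga_invK Y) -(ga_invK Z).
  rewrite /ga_wedge ga_grE !ga_lcontrE; apply: (congr1 (ga_iso G)).
  apply: filtered_mul_mixed_assoc; exact: disjoint_contained.
- by split=> // x X Y; exact: dcl.
- by split=> // x X Y; exact: dgr.
- by move=> p x xs _; exact: (lcontr_product e_basis (ga_one_cl G) dcl).
- by move=> p x xs _; exact: (lcontr_product e_basis (ga_one_gr G) dgr).
- by move=> p xs _; exact: orthogonal_product.
Qed.
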